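(* Consider the outer scheme described in the context with surrogate $J_k=\nabla F_1(v_k)$, model level $\delta=\beta$ and dual-step parameter $\rho_k=\beta$ (the local-Jacobian baseline). To reach $\mathrm{Gap}(\widetilde z_T)\le\varepsilon$ it needs $$T^{\mathrm{loc}}_\varepsilon=O\left(\left(\frac{L_1D^3}{\varepsilon}\right)^{2/3}+\frac{\beta D^2}{\varepsilon}\right)$$ outer iterations (that is, a number of iterations $T^{\mathrm{loc}}_\varepsilon$ of this order, as $\varepsilon\downarrow0$ and with an absolute implied constant, suffices), hence $N_{\mathrm{sync}}=2T^{\mathrm{loc}}_\varepsilon$ communication rounds and $N_{\mathrm{scal}}=2MdT^{\mathrm{loc}}_\varepsilon$ transmitted scalars, with $N_{\mathrm{JVP}}=N_J=0$ global Jacobian--vector products and global Jacobian evaluations.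
   Context: Norms are Euclidean; $\|\cdot\|_{\mathrm{op}}$ is the operator norm. $\mathcal Z\subset\mathbb R^d$ is nonempty, compact and convex with diameter $D>0$. $F=\sum_{i=1}^M w_iF_i$ with $w_i>0$, $\sum_i w_i=1$, all $F_i:\mathcal Z\to\mathbb R^d$ continuously differentiable; node $i$ of $M$ nodes can evaluate only $F_i$, and the server is node $1$. $F$ is monotone: $\langle F(x)-F(y),x-y\rangle\ge0$ for all $x,y\in\mathcal Z$; and $\|\nabla F(x)-\nabla F(y)\|_{\mathrm{op}}\le L_1\|x-y\|$ for all $x,y\in\mathcal Z$, $L_1>0$. $\beta=\sup_{z\in\mathcal Z}\|\nabla F(z)-\nabla F_1(z)\|_{\mathrm{op}}$. $\mathrm{Gap}(\widehat z)=\sup_{z\in\mathcal Z}\langle F(z),\widehat z-z\rangle$. Outer scheme (VIJI) with surrogates $J_k\in\mathbb R^{d\times d}$, model level $\delta\ge0$ and dual-step parameters $\rho_k\ge0$. Choose $z_0\in\mathcal Z$, $\sigma_0=0\in\mathbb R^d$. For $k=0,\dots,T-1$: (1) $v_k=\arg\max_{v\in\mathcal Z}\{\langle\sigma_k,v-z_0\rangle-\frac12\|v-z_0\|^2\}$; (2) take any $x_k\in\mathcal Z$ with $$\sup_{z\in\mathcal Z}\langle\Omega_{v_k,J_k,\delta}(x_k),x_k-z\rangle\le\frac{L_1}{2}\|x_k-v_k\|^3+\delta\|x_k-v_k\|^2,$$ where $\Omega_{v,J,\delta}(x)=F(v)+J(x-v)+(10\delta+5L_1\|x-v\|)(x-v)$;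 (3) choose $\lambda_k>0$ with $\frac1{32}\le\lambda_k\left(\frac{L_1}{2}\|x_k-v_k\|+\rho_k\right)\le\frac1{22}$; (4) $\sigma_{k+1}=\sigma_k-\lambda_kF(x_k)$. Output $\widetilde z_T=\left(\sum_{k=0}^{T-1}\lambda_k\right)^{-1}\sum_{k=0}^{T-1}\lambda_kx_k$. If the bracket in (3) is zero, the scheme stops and outputs $\widetilde z_T:=x_k$; the counts refer to runs performing all iterations. Communication accounting: each outer iteration uses two global operator values ($F(v_k)$ and $F(x_k)$); each global operator value is one communication round in which $Md$ scalars are transmitted. Evaluating $F_1$ and $\nabla F_1$ at the server costs no communication. *)

(* Defs.v *)
(* MathComp-Analysis, over an arbitrary [R : realType]. *)
From HB Require Import structures.
From mathcomp Require Import all_boot all_order all_algebra.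
From mathcomp Require Import all_classical all_reals all_analysis.
Set Implicit Arguments.
Unset Strict Implicit.
Unset Printing Implicit Defensive.
Import Order.TTheory GRing.Theory Num.Theory.
Import numFieldNormedType.Exports.
Local Open Scope classical_set_scope.
Local Open Scope ring_scope.

(* The library norm on matrices is the sup norm, so the Euclidean norm and the
   operator norm it induces are introduced here. The topology on ['cV[R]_d] and
   ['M[R]_d] is the library one, which these norms also generate. *)
Definition dot (R : realType) (d : nat) (u v : 'cV[R]_d) : R :=
  \sum_(i < d) u i 0 * v i 0.

Definition enorm (R : realType) (d : nat) (u : 'cV[R]_d) : R :=
  Num.sqrt (dot u u).

Definition opnorm (R : realType) (d : nat) (A : 'M[R]_d) : R :=
  sup [set enorm (A *m u) | u in [set u | enorm u <= 1]].

Definition diameter (R : realType) (d : nat) (Z : set 'cV[R]_d) : R :=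
  sup [set enorm (p.1 - p.2) | p in Z `*` Z].

(* Operators are only given on [Z], which may have empty interior, so
   differentiability is relative to [Z] and a continuous Jacobian field [dG] is
   part of the data. It is unique when [Z] has nonempty interior, and the
   Jacobian of a C^1 extension to a neighbourhood of [Z] always qualifies. *)
Definition is_jacobian_within (R : realType) (d : nat) (Z : set 'cV[R]_d)
    (G : 'cV[R]_d -> 'cV[R]_d) (x : 'cV[R]_d) (A : 'M[R]_d) : Prop :=
  forall e : R, 0 < e ->
    \forall y \near within Z (nbhs x),
      enorm (G y - G x - A *m (y - x)) <= e * enorm (y - x).

Definition C1_on (R : realType) (d : nat) (Z : set 'cV[R]_d)
    (G : 'cV[R]_d -> 'cV[R]_d) (dG : 'cV[R]_d -> 'M[R]_d) : Prop :=
  (forall x, Z x -> is_jacobian_within Z G x (dG x)) /\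
  {within Z, continuous dG}.

Definition monotone_on (R : realType) (d : nat) (Z : set 'cV[R]_d)
    (G : 'cV[R]_d -> 'cV[R]_d) : Prop :=
  forall x y, Z x -> Z y -> 0 <= dot (G x - G y) (x - y).

Definition lipschitz_jacobian_on (R : realType) (d : nat) (Z : set 'cV[R]_d)
    (dG : 'cV[R]_d -> 'M[R]_d) (L1 : R) : Prop :=
  forall x y, Z x -> Z y -> opnorm (dG x - dG y) <= L1 * enorm (x - y).

Definition jacobian_gap (R : realType) (d : nat) (Z : set 'cV[R]_d)
    (dG dH : 'cV[R]_d -> 'M[R]_d) : R :=
  sup [set opnorm (dG z - dH z) | z in Z].

Definition gap (R : realType) (d : nat) (Z : set 'cV[R]_d)
    (F : 'cV[R]_d -> 'cV[R]_d) (zhat : 'cV[R]_d) : R :=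
  sup [set dot (F z) (zhat - z) | z in Z].

Definition Omega (R : realType) (d : nat) (F : 'cV[R]_d -> 'cV[R]_d)
    (L1 : R) (v : 'cV[R]_d) (J : 'M[R]_d) (delta : R) (x : 'cV[R]_d) :
    'cV[R]_d :=
  F v + J *m (x - v) + (10 * delta + 5 * L1 * enorm (x - v)) *: (x - v).

(* Sequences are total; a run of [T] iterations only constrains
   [tr_v], [tr_x], [tr_lam] below [T] and [tr_sigma] up to [T]. *)
Record trajectory (R : realType) (d : nat) := Trajectory {
  tr_z0 : 'cV[R]_d;
  tr_v : nat -> 'cV[R]_d;
  tr_x : nat -> 'cV[R]_d;
  tr_lam : nat -> R;
  tr_sigma : nat -> 'cV[R]_d
}.

Definition dual_objective (R : realType) (d : nat)
    (z0 sigma v : 'cV[R]_d) : R :=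
  dot sigma (v - z0) - 2^-1 * enorm (v - z0) ^+ 2.

(* Steps (1) and (2). *)
Definition viji_points (R : realType) (d : nat) (Z : set 'cV[R]_d)
    (F : 'cV[R]_d -> 'cV[R]_d) (L1 : R) (J : nat -> 'M[R]_d) (delta : R)
    (tr : trajectory R d) (k : nat) : Prop :=
  let v := tr_v tr k in
  let x := tr_x tr k in
  [/\ Z v,
      forall u, Z u -> dual_objective (tr_z0 tr) (tr_sigma tr k) u
                       <= dual_objective (tr_z0 tr) (tr_sigma tr k) v,
      Z x &
      sup [set dot (Omega F L1 v (J k) delta x) (x - z) | z in Z]
        <= L1 / 2 * enorm (x - v) ^+ 3 + delta * enorm (x - v) ^+ 2].

Definition viji_bracket (R : realType) (d : nat) (L1 : R) (rho : nat -> R)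
    (tr : trajectory R d) (k : nat) : R :=
  L1 / 2 * enorm (tr_x tr k - tr_v tr k) + rho k.

(* Steps (3) and (4). *)
Definition viji_dual_step (R : realType) (d : nat)
    (F : 'cV[R]_d -> 'cV[R]_d) (L1 : R) (rho : nat -> R)
    (tr : trajectory R d) (k : nat) : Prop :=
  let b := viji_bracket L1 rho tr k in
  [/\ 0 < tr_lam tr k,
      32^-1 <= tr_lam tr k * b <= 22^-1 &
      tr_sigma tr k.+1 = tr_sigma tr k - tr_lam tr k *: F (tr_x tr k)].

Definition viji_run (R : realType) (d : nat) (Z : set 'cV[R]_d)
    (F : 'cV[R]_d -> 'cV[R]_d) (L1 : R) (J : nat -> 'M[R]_d) (delta : R)
    (rho : nat -> R) (tr : trajectory R d) (T : nat) : Prop :=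
  [/\ Z (tr_z0 tr), tr_sigma tr 0%N = 0 &
      forall k, (k < T)%N ->
        viji_points Z F L1 J delta tr k /\ viji_dual_step F L1 rho tr k].

Definition weighted_average (R : realType) (d : nat)
    (tr : trajectory R d) (T : nat) : 'cV[R]_d :=
  (\sum_(k < T) tr_lam tr k)^-1 *: \sum_(k < T) tr_lam tr k *: tr_x tr k.

(* The scheme, given a budget of [T] iterations, outputs [zhat]: either all
   iterations are performed, or the bracket vanishes at some [k < T]. *)
Definition viji_output (R : realType) (d : nat) (Z : set 'cV[R]_d)
    (F : 'cV[R]_d -> 'cV[R]_d) (L1 : R) (J : nat -> 'M[R]_d) (delta : R)
    (rho : nat -> R) (tr : trajectory R d) (T : nat) (zhat : 'cV[R]_d) : Prop :=
  (viji_run Z F L1 J delta rho tr T /\ zhat = weighted_average tr T) \/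
  (exists k, [/\ (k < T)%N,
                 viji_run Z F L1 J delta rho tr k,
                 viji_points Z F L1 J delta tr k,
                 viji_bracket L1 rho tr k = 0 &
                 zhat = tr_x tr k]).

(* [Global*] queries need all nodes; [ServerJac z] is the Jacobian of the
   server's own operator at [z]. *)
Inductive query (R : realType) (d : nat) :=
  | GlobalOp of 'cV[R]_d
  | GlobalJVP of 'cV[R]_d & 'cV[R]_d
  | GlobalJac of 'cV[R]_d
  | ServerJac of 'cV[R]_d.

(* A surrogate rule maps the prox point [v_k] to [J_k] together with the
   queries spent on building it. *)
Definition surrogate_rule (R : realType) (d : nat) :=
  'cV[R]_d -> 'M[R]_d * seq (query R d).

Definition local_jacobian_rule (R : realType) (d : nat)
    (dF1 : 'cV[R]_d -> 'M[R]_d) : surrogate_rule R d :=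
  fun v => (dF1 v, [:: ServerJac v]).

Definition surrogate_seq (R : realType) (d : nat) (S : surrogate_rule R d)
    (tr : trajectory R d) : nat -> 'M[R]_d :=
  fun k => (S (tr_v tr k)).1.

Definition viji_log (R : realType) (d : nat) (S : surrogate_rule R d)
    (tr : trajectory R d) (T : nat) : seq (query R d) :=
  flatten [seq GlobalOp (tr_v tr k) ::
               (S (tr_v tr k)).2 ++ [:: GlobalOp (tr_x tr k)]
          | k <- iota 0 T].

Definition is_global_jvp (R : realType) (d : nat) (q : query R d) : bool :=
  if q is GlobalJVP _ _ then true else false.

Definition is_global_jac (R : realType) (d : nat) (q : query R d) : bool :=
  if q is GlobalJac _ then true else false.

Definition is_global (R : realType) (d : nat) (q : query R d) : bool :=
  if q is ServerJac _ then false else true.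

(* Each of the [M] nodes sends its own operator value, Jacobian-vector product
   (both [d] scalars) or Jacobian ([d * d] scalars). *)
Definition query_scalars (R : realType) (M d : nat) (q : query R d) : nat :=
  match q with
  | GlobalOp _ | GlobalJVP _ _ => M * d
  | GlobalJac _ => M * (d * d)
  | ServerJac _ => 0
  end.

Definition N_sync (R : realType) (d : nat) (log : seq (query R d)) : nat :=
  count (@is_global R d) log.

Definition N_scal (R : realType) (M d : nat) (log : seq (query R d)) : nat :=
  sumn [seq query_scalars M q | q <- log].

Definition N_JVP (R : realType) (d : nat) (log : seq (query R d)) : nat :=
  count (@is_global_jvp R d) log.

Definition N_J (R : realType) (d : nat) (log : seq (query R d)) : nat :=
  count (@is_global_jac R d) log.

(* Main.v *)
Require Import Defs.
From HB Require Import structures.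
From mathcomp Require Import all_boot all_order all_algebra.
From mathcomp Require Import all_classical all_reals all_analysis.
From mathcomp Require Import ring lra.
Set Implicit Arguments.
Unset Strict Implicit.
Unset Printing Implicit Defensive.
Import Order.TTheory GRing.Theory Num.Theory.
Import numFieldNormedType.Exports.
Local Open Scope classical_set_scope.
Local Open Scope ring_scope.

(** With [e_k = enorm (x_k - v_k)] and [beta] bounding the error of the server's
    Jacobian, the subproblem at iteration [k] is a regularized linear model of
    the operator whose error is at most [(L1 / 2 * e_k + beta) * e_k]
    ([surrogate_model_error]: Taylor's estimate plus the Jacobian error). The
    bracket [L1 / 2 * e_k + beta] of the dual step is exactly this factor, and
    the constants of the scheme are tuned so that
    [lam_k * dot (F x_k) (x_k - u)] is at most
    [2^-1 * enorm (u - v_k) ^+ 2 - 7^-1 * e_k ^+ 2] for every [u] in the domain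
    ([one_step_descent]). The quadratic term is paid for by the strong concavity
    of the dual objective maximized at [v_k] ([dual_objective_max_gap]), so the
    inequalities telescope ([viji_energy]):

    [\sum_k lam_k * dot (F x_k) (x_k - u) + 7^-1 * \sum_k e_k ^+ 2
       <= 2^-1 * D ^+ 2].

    By monotonicity the first sum is at least the total weight times
    [dot (F u) (zhat - u)], [zhat] being the weighted average. Suppose that this
    inner product exceeds [eps] at some [u]. Then [\sum_k e_k ^+ 2] is
    [O(D ^+ 2)], so that [e_k] is typically [O(D / sqrt T)], and since [lam_k]
    is at least [1 / 32] divided by the bracket, the total weight is at least of
    order [T / (L1 * D / sqrt T + beta)] ([total_weight_ge]). The energy
    inequality also bounds it by [D ^+ 2 / (2 * eps)], hence
    [T = O(L1 * D ^+ 3 / (eps * sqrt T) + beta * D ^+ 2 / eps)], which fails once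
    [T] is a large enough multiple of
    [(L1 * D ^+ 3 / eps) `^ (2 / 3) + beta * D ^+ 2 / eps] ([viji_run_gap]).

    If the scheme stops early, then [x_k = v_k] and [beta = 0], and [x_k] solves
    the variational inequality exactly ([viji_stop_gap]). Each iteration queries
    the nodes twice, at [v_k] and [x_k]; building the surrogate queries only the
    server. *)

(** * Euclidean geometry of column vectors *)

Section Euclidean.
Context {R : realType} {d : nat}.
Implicit Types (u v h : 'cV[R]_d) (A : 'M[R]_d) (a : R).

Lemma dotC u v : dot u v = dot v u.
Proof. by apply: eq_bigr => i _; rewrite mulrC. Qed.

Lemma dotDl u1 u2 v : dot (u1 + u2) v = dot u1 v + dot u2 v.
Proof.
by rewrite /dot -big_split /=; apply: eq_bigr => i _; rewrite mxE mulrDl.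
Qed.

Lemma dotZl a u v : dot (a *: u) v = a * dot u v.
Proof. by rewrite /dot mulr_sumr; apply: eq_bigr => i _; rewrite mxE mulrA. Qed.

Lemma dotNl u v : dot (- u) v = - dot u v.
Proof. by rewrite -scaleN1r dotZl mulN1r. Qed.

Lemma dot0l v : dot 0 v = 0.
Proof. by rewrite -(scale0r 0) dotZl mul0r. Qed.

Lemma dotDr u v1 v2 : dot u (v1 + v2) = dot u v1 + dot u v2.
Proof. by rewrite dotC dotDl !(dotC u). Qed.

Lemma dotZr a u v : dot u (a *: v) = a * dot u v.
Proof. by rewrite dotC dotZl dotC. Qed.

Lemma dotNr u v : dot u (- v) = - dot u v.
Proof. by rewrite dotC dotNl dotC. Qed.

Lemma dot0r u : dot u 0 = 0.
Proof. by rewrite dotC dot0l. Qed.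

(** Expands inner products of linear combinations, after which [ring] and [lra]
    treat the remaining inner products as atoms. *)
Definition dotE := (dotDl, dotDr, dotNl, dotNr, dotZl, dotZr).

Lemma dot_suml (I : Type) (r : seq I) (P : pred I) (f : I -> 'cV[R]_d) v :
  dot (\sum_(i <- r | P i) f i) v = \sum_(i <- r | P i) dot (f i) v.
Proof.
elim/big_rec2: _ => [|i x y _ <-]; first by rewrite dot0l.
by rewrite dotDl.
Qed.

Lemma dot_ge0 u : 0 <= dot u u.
Proof. by apply: sumr_ge0 => i _; exact: sqr_ge0. Qed.

Lemma dot_eq0 u : dot u u = 0 -> u = 0.
Proof.
move/eqP; rewrite psumr_eq0 => [/allP u0|i _]; last exact: sqr_ge0.
apply/colP => i; rewrite mxE; apply/eqP.
by have := u0 i (mem_index_enum i); rewrite mulf_eq0 orbb.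
Qed.

Lemma enorm_ge0 u : 0 <= enorm u.
Proof. exact: sqrtr_ge0. Qed.

Lemma enorm_sqr u : enorm u ^+ 2 = dot u u.
Proof. by rewrite sqr_sqrtr // dot_ge0. Qed.

Lemma enorm_eq0 u : enorm u = 0 -> u = 0.
Proof. by move=> u0; apply: dot_eq0; rewrite -enorm_sqr u0 expr0n. Qed.

Lemma enorm0 : enorm (0 : 'cV[R]_d) = 0.
Proof. by rewrite /enorm dot0l sqrtr0. Qed.

Lemma enormZ a u : enorm (a *: u) = `|a| * enorm u.
Proof.
by rewrite /enorm dotZl dotZr mulrA -expr2 sqrtrM ?sqr_ge0 // sqrtr_sqr.
Qed.

Lemma enormN u : enorm (- u) = enorm u.
Proof. by rewrite /enorm dotNl dotNr opprK. Qed.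

Lemma enormB u v : enorm (u - v) = enorm (v - u).
Proof. by rewrite -enormN opprB. Qed.

Lemma dot_le u v : dot u v <= enorm u * enorm v.
Proof.
have [u0|u0] := eqVneq (enorm u) 0.
  by rewrite (enorm_eq0 u0) dot0l enorm0 mul0r.
have [v0|v0] := eqVneq (enorm v) 0.
  by rewrite (enorm_eq0 v0) dot0r enorm0 mulr0.
have ugt : 0 < enorm u by rewrite lt_def u0 enorm_ge0.
have vgt : 0 < enorm v by rewrite lt_def v0 enorm_ge0.
have := dot_ge0 (enorm v *: u - enorm u *: v).
rewrite !dotE -!enorm_sqr (dotC v u).
have uv := mulr_gt0 ugt vgt.
rewrite -[dot u v <= _](ler_pM2l uv); lra.
Qed.

Lemma abs_dot_le u v : `|dot u v| <= enorm u * enorm v.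
Proof. by rewrite ler_norml dot_le lerNl -dotNl -(enormN u) dot_le. Qed.

Lemma enormD u v : enorm (u + v) <= enorm u + enorm v.
Proof.
rewrite -(ler_pXn2r (n := 2)) ?nnegrE ?addr_ge0 ?enorm_ge0 //.
rewrite enorm_sqr sqrrD !enorm_sqr !dotE (dotC v u).
have := dot_le u v; lra.
Qed.

Lemma enorm_sum (I : Type) (r : seq I) (P : pred I) (f : I -> 'cV[R]_d) :
  enorm (\sum_(i <- r | P i) f i) <= \sum_(i <- r | P i) enorm (f i).
Proof.
elim/big_rec2: _ => [|i x y _ le_yx]; first by rewrite enorm0.
by apply: le_trans (enormD _ _) _; rewrite lerD2l.
Qed.

(** The topology is that of the entrywise sup norm. The crude comparisons of
    this norm with [enorm] and [opnorm] serve to show that suprema over compact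
    sets are finite, where constants are irrelevant. *)
Lemma mx_entry_le m n (A : 'M[R]_(m, n)) i j : `|A i j| <= `|A|.
Proof.
rewrite {2}/Num.norm /= mx_normrE.
by apply/bigmax_geP; right; exists (i, j).
Qed.

Lemma enorm_le_norm u : enorm u <= d%:R * `|u|.
Proof.
rewrite -(ler_pXn2r (n := 2)) ?nnegrE ?mulr_ge0 ?enorm_ge0 //.
rewrite enorm_sqr.
apply: (@le_trans _ _ (\sum_(i < d) `|u| ^+ 2)).
  apply: ler_sum => i _.
  by rewrite -expr2 -real_normK ?num_real // lerXn2r ?nnegrE // mx_entry_le.
rewrite sumr_const card_ord -[leLHS]mulr_natl exprMn ler_wpM2r ?sqr_ge0 //.
by rewrite -natrX ler_nat; case: (d) => // k; rewrite -{1}(expn1 k.+1) leq_pexp2l.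
Qed.

Lemma enorm_mulmx_le A u : enorm (A *m u) <= (d%:R * `|A|) * enorm u.
Proof.
rewrite -(ler_pXn2r (n := 2)) ?nnegrE ?mulr_ge0 ?enorm_ge0 //.
rewrite enorm_sqr !exprMn.
(* the entries of [A *m u] are the inner products of the rows of [A] with [u] *)
have entry i : (A *m u) i 0 = dot (row i A)^T u.
  by rewrite mxE; apply: eq_bigr => j _; rewrite !mxE.
have row_le i : dot (row i A)^T (row i A)^T <= d%:R * `|A| ^+ 2.
  rewrite mulr_natl -[X in _ *+ X]card_ord -sumr_const.
  apply: ler_sum => j _; rewrite !mxE -expr2 -real_normK ?num_real //.
  by rewrite lerXn2r ?nnegrE // mx_entry_le.
apply: (@le_trans _ _ (\sum_(i < d) d%:R * `|A| ^+ 2 * enorm u ^+ 2)).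
  apply: ler_sum => i _; rewrite entry -expr2.
  apply: (@le_trans _ _ (enorm (row i A)^T ^+ 2 * enorm u ^+ 2)).
    rewrite -exprMn -real_normK ?num_real // lerXn2r ?nnegrE ?mulr_ge0 ?enorm_ge0 //.
    exact: abs_dot_le.
  by rewrite ler_wpM2r ?sqr_ge0 // enorm_sqr row_le.
rewrite sumr_const card_ord -[leLHS]mulr_natl.
by rewrite le_eqVlt; apply/orP; left; apply/eqP; ring.
Qed.

Lemma opnorm_has_ub A :
  has_ubound [set enorm (A *m u) | u in [set u | enorm u <= 1]].
Proof.
exists (d%:R * `|A|) => _ [u /= u1 <-].
apply: le_trans (enorm_mulmx_le _ _) _.
by rewrite -[leRHS]mulr1 ler_wpM2l // mulr_ge0.
Qed.

Lemma opnorm_le A : opnorm A <= d%:R * `|A|.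
Proof.
apply: ge_sup.
  by exists (enorm (A *m 0)); exists 0 => //=; rewrite enorm0 ler01.
move=> _ [u /= u1 <-]; apply: le_trans (enorm_mulmx_le _ _) _.
by rewrite -[leRHS]mulr1 ler_wpM2l // mulr_ge0.
Qed.

Lemma opnorm_ge0 A : 0 <= opnorm A.
Proof.
apply: (@le_trans _ _ (enorm (A *m 0))); first exact: enorm_ge0.
apply: (ub_le_sup (opnorm_has_ub A)).
by exists 0 => //=; rewrite enorm0 ler01.
Qed.

Lemma enorm_mulmx A u : enorm (A *m u) <= opnorm A * enorm u.
Proof.
have [u0|u0] := eqVneq (enorm u) 0.
  by rewrite (enorm_eq0 u0) mulmx0 enorm0 mulr0.
have ugt : 0 < enorm u by rewrite lt_def u0 enorm_ge0.
have un : `|(enorm u)^-1| = (enorm u)^-1 by rewrite ger0_norm // invr_ge0 ltW.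
rewrite -ler_pdivrMr // mulrC -un -enormZ scalemxAr.
apply: (ub_le_sup (opnorm_has_ub A)).
by exists ((enorm u)^-1 *: u) => //=; rewrite enormZ un mulVf.
Qed.

End Euclidean.

(** * First-order Taylor estimate on a convex set *)

(** One-sided derivative bounds integrate by the mean value theorem applied to
    [f t - K / 2 * t ^+ 2]. The derivative at the endpoints of [[0, 1]] is
    one-sided, hence the formulation by within-neighbourhood estimates; they
    give differentiability in the interior and continuity up to the ends. *)
Lemma integrate_linear_slope (R : realType) (f df : R -> R) (K : R) :
  (forall s : R, 0 <= s <= 1 -> forall e : R, 0 < e ->
    \forall t \near within `[0, 1]%classic (nbhs s),
      `|f t - f s - df s * (t - s)| <= e * `|t - s|) ->
  (forall s : R, 0 <= s <= 1 -> df s <= K * s) ->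
  f 1 - f 0 <= K / 2.
Proof.
move=> f_df df_le.
have derivf (s : R) : s \in `]0, 1[%R -> is_derive s 1 f (df s).
  move=> s01; have s01' : 0 <= s <= 1.
    by move: s01; rewrite in_itv /= => /andP[? ?]; rewrite !ltW.
  have cvgdf : h^-1 *: (f (h *: 1 + s) - f s) @[h --> 0^'] --> df s.
    apply/cvgrPdist_le => e e0.
    have : \forall t \near nbhs s, `|f t - f s - df s * (t - s)| <= e * `|t - s|.
      have <- : within `[0, 1]%classic (nbhs s) = nbhs s.
        apply: within_interior; rewrite interior_itv_bnd //.
      exact: f_df.
    move=> /nbhs_ballP[r /= r0 ballr].
    near=> h.
    have h0 : h != 0 by near: h; exact: nbhs_dnbhs_neq.
    have /ballr : ball s r (h *: 1 + s).
      rewrite -ball_normE /ball_ /= opprD addrCA subrr addr0 normrN.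
      rewrite [_ *: _]mulr1.
      by near: h; apply: dnbhs0_lt.
    rewrite /= [h *: 1]mulr1 addrK => fh.
    have -> : df s - h^-1 *: (f (h + s) - f s)
              = - (h^-1 * (f (h + s) - f s - df s * h)).
      by rewrite /GRing.scale /=; field.
    rewrite normrN normrM normfV ler_pdivrMl ?normr_gt0 //.
    by rewrite [leRHS]mulrC.
  by split; [apply/cvg_ex; exists (df s) | apply/cvg_lim].
have contf : {within `[0, 1], continuous f}.
  apply/subspace_continuousP => s; rewrite /= in_itv /= => s01.
  apply/cvgrPdist_le => e e0.
  have c0 : 0 < `|df s| + 1 by rewrite ltr_wpDl.
  near=> t.
  have ft : `|f t - f s - df s * (t - s)| <= 1 * `|t - s|.
    by near: t; exact: f_df.
  have ts : `|t - s| <= e / (`|df s| + 1).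
    near: t; apply: cvg_within.
    by rewrite near_simpl; apply: (cvgr_distC_le) => //; rewrite divr_gt0.
  have -> : f s - f t = - ((f t - f s - df s * (t - s)) + df s * (t - s)).
    by ring.
  rewrite normrN; apply: le_trans (ler_normD _ _) _.
  move: ts; rewrite ler_pdivlMr // normrM => ts.
  by apply: le_trans ts; lra.
pose g : R -> R := fun t => f t - (K / 2) * t ^+ 2.
have derivg (s : R) : s \in `]0, 1[%R -> is_derive s 1 g (df s - K * s).
  move=> /derivf fs; rewrite /g.
  apply: is_derive_eq.
  by rewrite /GRing.scale /=; field.
have contg : {within `[0, 1], continuous g}.
  apply: within_continuousB => //.
  apply: derivable_within_continuous => x _.
  exact: ex_derive.
have [c] := MVT_segment ler01 derivg contg.
rewrite in_itv /= => /df_le dfc; rewrite /g subr0 mulr1 => eqg.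
move: dfc eqg; lra.
Unshelve. all: by end_near.
Qed.

Lemma convex_set_segment (R : realType) (d : nat) (Z : set 'cV[R]_d)
    (u v : 'cV[R]_d) (t : R) :
  convex_set Z -> Z u -> Z v -> 0 <= t <= 1 -> Z (u + t *: (v - u)).
Proof.
move=> cvxZ Zu Zv /andP[t0 t1].
have := cvxZ v u (Itv01 t0 t1); rewrite !inE => /(_ Zv Zu).
suff -> : conv (Itv01 t0 t1) (v : convex_lmodType 'cV[R]_d) u
          = u + t *: (v - u) by [].
by rewrite /conv /= /unstable.onem scalerBr scalerBl scale1r addrCA.
Qed.

(** Testing the remainder against itself, written [h], reduces the claim to
    the scalar function [t |-> dot h (F (v + t *: (x - v)))] on [[0, 1]]. *)
Lemma taylor_remainder (R : realType) (d : nat) (Z : set 'cV[R]_d)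
    (F : 'cV[R]_d -> 'cV[R]_d) (dF : 'cV[R]_d -> 'M[R]_d) (L : R)
    (v x : 'cV[R]_d) :
  convex_set Z -> (forall z, Z z -> is_jacobian_within Z F z (dF z)) ->
  lipschitz_jacobian_on Z dF L -> Z v -> Z x ->
  enorm (F x - F v - dF v *m (x - v)) <= L / 2 * enorm (x - v) ^+ 2.
Proof.
move=> cvxZ jacF lipF Zv Zx.
set h := F x - _ - _; set w := x - v.
have [h0|h_neq0] := eqVneq (enorm h) 0.
  have L0 : 0 <= L * enorm w.
    by apply: le_trans (lipF _ _ Zx Zv); exact: opnorm_ge0.
  have -> : L / 2 * enorm w ^+ 2 = (L * enorm w) * enorm w / 2 by ring.
  by rewrite h0 divr_ge0 // mulr_ge0 ?enorm_ge0.
have h_gt0 : 0 < enorm h by rewrite lt_def h_neq0 enorm_ge0.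
pose y (t : R) := v + t *: w.
have Zy t : 0 <= t <= 1 -> Z (y t) by exact: convex_set_segment.
pose f (t : R) := dot h (F (y t)) - t * dot h (dF v *m w).
pose df (s : R) := dot h ((dF (y s) - dF v) *m w).
have := @integrate_linear_slope R f df (L * enorm w ^+ 2 * enorm h).
have -> : f 1 - f 0 = enorm h ^+ 2.
  have y1 : y 1 = x by rewrite /y scale1r addrC subrK.
  have y0 : y 0 = v by rewrite /y scale0r addr0.
  rewrite enorm_sqr /f y1 y0 -[RHS]/(dot h (F x - F v - dF v *m w)).
  by rewrite !dotE; ring.
move=> slope.
suff : enorm h ^+ 2 <= (L * enorm w ^+ 2 * enorm h) / 2.
  by rewrite expr2 mulrAC ler_pM2r // mulrAC.
apply: slope => [s s01 e e0|s s01]; last first.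
  rewrite /df; apply: le_trans (dot_le _ _) _.
  have -> : L * enorm w ^+ 2 * enorm h * s
            = enorm h * (L * (s * enorm w) * enorm w) by ring.
  rewrite ler_wpM2l ?enorm_ge0 //.
  apply: le_trans (enorm_mulmx _ _) _.
  rewrite ler_wpM2r ?enorm_ge0 //.
  apply: le_trans (lipF _ _ (Zy _ s01) Zv) _.
  rewrite /y addrC addKr enormZ ger0_norm //.
  by case/andP: s01.
(* the [+ 1] keeps the tolerance below positive when [w = 0] *)
have hw0 : 0 < enorm h * enorm w + 1.
  by rewrite ltr_wpDl // mulr_ge0 ?enorm_ge0.
have conty : {for s, continuous y}.
  apply: cvgD; first exact: cvg_cst.
  exact: scalel_continuous.
have := jacF _ (Zy _ s01) _ (divr_gt0 e0 hw0).
move=> /conty nbhs_y.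
near=> t.
have t01 : 0 <= t <= 1.
  have : `[0, 1]%classic t by near: t; exact: withinT.
  by rewrite /= in_itv.
have : Z (y t) -> enorm (F (y t) - F (y s) - dF (y s) *m (y t - y s)) <=
        e / (enorm h * enorm w + 1) * enorm (y t - y s).
  by near: t; apply: cvg_within; exact: nbhs_y.
have yts : y t - y s = (t - s) *: w.
  by rewrite /y opprD addrACA subrr add0r -scalerBl.
rewrite yts enormZ -scalemxAr.
have -> : f t - f s - df s * (t - s)
   = dot h (F (y t) - F (y s) - (t - s) *: (dF (y s) *m w)).
  by rewrite /f /df mulmxBl !dotE; ring.
move=> /(_ (Zy _ t01)) bnd.
apply: le_trans (abs_dot_le _ _) _.
apply: (@le_trans _ _ (enorm h * (e / (enorm h * enorm w + 1)
                        * (`|t - s| * enorm w)))).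
  by rewrite ler_wpM2l ?enorm_ge0.
have -> : enorm h * (e / (enorm h * enorm w + 1) * (`|t - s| * enorm w))
  = (e * `|t - s|) * ((enorm h * enorm w) / (enorm h * enorm w + 1)).
  by ring.
rewrite ler_piMr //; first by rewrite mulr_ge0 // ltW.
by rewrite ler_pdivrMr // mul1r lerDl.
Unshelve. all: by end_near.
Qed.

(** As the weights are positive and sum to [1], the same tolerance [e] works for
    the average as for each summand. *)
Lemma jacobian_within_sum (R : realType) (d M : nat) (Z : set 'cV[R]_d)
    (w : 'I_M -> R) (Fi : 'I_M -> 'cV[R]_d -> 'cV[R]_d)
    (dFi : 'I_M -> 'cV[R]_d -> 'M[R]_d) (x : 'cV[R]_d) :
  (forall i, 0 < w i) -> \sum_(i < M) w i = 1 ->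
  (forall i, is_jacobian_within Z (Fi i) x (dFi i x)) ->
  is_jacobian_within Z (fun z => \sum_(i < M) w i *: Fi i z) x
    (\sum_(i < M) w i *: dFi i x).
Proof.
move=> w_gt0 w_sum jac e e0.
have : \forall y \near within Z (nbhs x), forall i,
    enorm (Fi i y - Fi i x - dFi i x *m (y - x)) <= e * enorm (y - x).
  by apply: filter_forall => i; exact: jac.
apply: filterS => y jacy.
have -> : \sum_(i < M) w i *: Fi i y - \sum_(i < M) w i *: Fi i x -
      (\sum_(i < M) w i *: dFi i x) *m (y - x) =
   \sum_(i < M) w i *: (Fi i y - Fi i x - dFi i x *m (y - x)).
  rewrite mulmx_suml -!sumrB; apply: eq_bigr => i _.
  by rewrite !scalerBr scalemxAl.
apply: le_trans (enorm_sum _ _ _) _.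
rewrite -[leRHS]mul1r -w_sum mulr_suml; apply: ler_sum => i _.
by rewrite enormZ gtr0_norm // ler_pM2l.
Qed.

(** * Finiteness of the suprema *)

(** The supremum of an unbounded set of reals is [0] here, so each supremum of
    the problem is usable only once its set is known to be bounded; this is
    what compactness of the domain provides. *)
Lemma continuous_compact_norm_le (R : realType) (T : topologicalType)
    (V : normedModType R) (Z : set T) (g : T -> V) :
  compact Z -> {within Z, continuous g} ->
  exists B : R, forall z, Z z -> `|g z| <= B.
Proof.
move=> cZ cg.
have /compact_bounded /pinfty_ex_gt0 [B _ gB] := continuous_compact cg cZ.
by exists B => z Zz; apply: gB; exists z.
Qed.

Lemma enorm_le_diameter (R : realType) (d : nat) (Z : set 'cV[R]_d)
    (x y : 'cV[R]_d) :
  compact Z -> Z x -> Z y -> enorm (x - y) <= diameter Z.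
Proof.
move=> cZ Zx Zy.
have [B ZB] : exists B : R, forall z, Z z -> `|z| <= B.
  apply: continuous_compact_norm_le => //; apply: continuous_subspaceT.
  by move=> z; exact: cvg_id.
apply: ub_le_sup; last by exists (x, y).
exists (d%:R * (B + B)) => _ [[u v] [/= Zu Zv] <-].
apply: le_trans (enorm_le_norm _) _; rewrite ler_wpM2l //.
by apply: le_trans (ler_normB _ _) _; rewrite lerD // ZB.
Qed.

Lemma opnorm_le_jacobian_gap (R : realType) (d M : nat) (Z : set 'cV[R]_d)
    (w : 'I_M -> R) (dFi : 'I_M -> 'cV[R]_d -> 'M[R]_d) (s : 'I_M)
    (z : 'cV[R]_d) :
  compact Z -> (forall i, {within Z, continuous (dFi i)}) -> Z z ->
  opnorm (\sum_(i < M) w i *: dFi i z - dFi s z)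
    <= jacobian_gap Z (fun z => \sum_(i < M) w i *: dFi i z) (dFi s).
Proof.
move=> cZ cdF Zz.
have /choice [B dFB] : forall i, exists B : R, forall z, Z z -> `|dFi i z| <= B.
  by move=> i; exact: continuous_compact_norm_le.
apply: ub_le_sup; last by exists z.
exists (d%:R * (\sum_(i < M) `|w i| * B i + B s)) => _ [u Zu <-].
apply: le_trans (opnorm_le _) _; rewrite ler_wpM2l //.
apply: le_trans (ler_normB _ _) _; rewrite lerD ?dFB //.
apply: le_trans (ler_norm_sum _ _ _) _; apply: ler_sum => i _.
by rewrite normrZ ler_wpM2l ?dFB.
Qed.

Lemma dot_le_sup (R : realType) (d : nat) (Z : set 'cV[R]_d)
    (g x z : 'cV[R]_d) :
  compact Z -> Z x -> Z z ->
  dot g (x - z) <= sup [set dot g (x - u) | u in Z].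
Proof.
move=> cZ Zx Zz; apply: ub_le_sup; last by exists z.
exists (enorm g * diameter Z) => _ [u Zu <-].
apply: le_trans (dot_le _ _) _.
by rewrite ler_wpM2l ?enorm_ge0 // enorm_le_diameter.
Qed.

Lemma gap_le (R : realType) (d : nat) (Z : set 'cV[R]_d)
    (F : 'cV[R]_d -> 'cV[R]_d) (zhat : 'cV[R]_d) (eps : R) :
  Z !=set0 -> (forall z, Z z -> dot (F z) (zhat - z) <= eps) ->
  gap Z F zhat <= eps.
Proof.
move=> [z0 Zz0] le_eps; apply: ge_sup; first by exists (dot (F z0) (zhat - z0)), z0.
by move=> _ [z Zz <-]; exact: le_eps.
Qed.

(** * One iteration of the scheme *)

(** The dual objective is a concave quadratic of modulus [1], so its maximum
    over a convex set is strict by [2^-1 * enorm (u - v) ^+ 2]: moving from [v]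
    towards [u] by a small step [t] shows that the slope at [v] is at most
    [t / 2 * enorm (u - v) ^+ 2] for every [t] in [(0, 1]]. *)
Lemma dual_objective_max_gap (R : realType) (d : nat) (Z : set 'cV[R]_d)
    (z0 sigma v u : 'cV[R]_d) :
  convex_set Z -> Z v -> Z u ->
  (forall u, Z u -> dual_objective z0 sigma u <= dual_objective z0 sigma v) ->
  dual_objective z0 sigma u + 2^-1 * enorm (u - v) ^+ 2
    <= dual_objective z0 sigma v.
Proof.
move=> cvxZ Zv Zu vmax.
set q := enorm (u - v) ^+ 2; set slope := dot (sigma - (v - z0)) (u - v).
have expand t : dual_objective z0 sigma (v + t *: (u - v))
    = dual_objective z0 sigma v + t * slope - t ^+ 2 / 2 * q.
  have -> : v + t *: (u - v) = t *: (u - v) + (v - z0) + z0.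
    by rewrite -addrA subrK addrC.
  rewrite /dual_objective addrK /q /slope !enorm_sqr.
  move: (u - v) (v - z0) => a b.
  by rewrite !dotE (dotC b a); field.
have -> : dual_objective z0 sigma u = dual_objective z0 sigma v + slope - q / 2.
  have := expand 1; rewrite scale1r [v + _]addrC subrK => ->.
  by field.
suff : slope <= 0 by lra.
have slope_le t : 0 < t <= 1 -> slope <= t / 2 * q.
  move=> /andP[t0 t1].
  have := vmax _ (convex_set_segment cvxZ Zv Zu (t := t) _).
  rewrite ltW // t1 expand => /(_ isT).
  rewrite -[slope <= _](ler_pM2l t0).
  by lra.
apply/ler_addgt0Pl => e e0; rewrite addr0.
have q0 : 0 <= q by rewrite exprn_ge0 // enorm_ge0.
have q1 : 0 < q + 1 by rewrite ltr_wpDl.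
have t01 : 0 < Num.min 1 (e / (q + 1)) <= 1.
  by rewrite lt_min ltr01 divr_gt0 //= ge_min lexx.
apply: le_trans (slope_le _ t01) _.
apply: (@le_trans _ _ (e / (q + 1) * q)).
  rewrite ler_wpM2r //.
  have : Num.min 1 (e / (q + 1)) <= e / (q + 1) by rewrite ge_min lexx orbT.
  case/andP: t01; lra.
rewrite mulrAC ler_pdivrMr // ler_wpM2l ?ltW //; lra.
Qed.

(** Replacing [J] by the Jacobian of [F] at [v] costs [delta * e], and the
    linear model with the exact Jacobian is accurate up to [L1 / 2 * e ^+ 2]. *)
Lemma surrogate_model_error (R : realType) (d : nat) (Z : set 'cV[R]_d)
    (F : 'cV[R]_d -> 'cV[R]_d) (dF : 'cV[R]_d -> 'M[R]_d) (J : 'M[R]_d)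
    (L1 delta : R) (v x : 'cV[R]_d) :
  convex_set Z -> (forall z, Z z -> is_jacobian_within Z F z (dF z)) ->
  lipschitz_jacobian_on Z dF L1 -> Z v -> Z x -> opnorm (dF v - J) <= delta ->
  enorm (F x - F v - J *m (x - v))
    <= (L1 / 2 * enorm (x - v) + delta) * enorm (x - v).
Proof.
move=> cvxZ jacF lipF Zv Zx J_near.
have -> : F x - F v - J *m (x - v)
    = (F x - F v - dF v *m (x - v)) + (dF v - J) *m (x - v).
  by rewrite mulmxBl addrA subrK.
apply: le_trans (enormD _ _) _; rewrite mulrDl lerD //.
  by rewrite -mulrA -expr2 (taylor_remainder cvxZ jacF lipF).
apply: le_trans (enorm_mulmx _ _) _.
by rewrite ler_wpM2r ?enorm_ge0.
Qed.

(** With [e = enorm (x - v)], [r = enorm (u - v)] and [b = L1 / 2 * e + delta],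
    the subproblem, the regularizer and the model error contribute
    [b * e ^+ 2], [- 10 * b * (e ^+ 2 - e * r)] and [b * e * (e + r)]. For
    [lam * b] in the prescribed range, completing the square in [r] leaves a
    negative multiple of [e ^+ 2]. *)
Lemma one_step_descent (R : realType) (d : nat) (F : 'cV[R]_d -> 'cV[R]_d)
    (J : 'M[R]_d) (L1 delta lam : R) (v x u : 'cV[R]_d) :
  let e := enorm (x - v) in
  let b := L1 / 2 * e + delta in
  enorm (F x - F v - J *m (x - v)) <= b * e ->
  dot (Omega F L1 v J delta x) (x - u) <= b * e ^+ 2 ->
  0 < lam -> 32^-1 <= lam * b <= 22^-1 ->
  lam * dot (F x) (x - u) <= 2^-1 * enorm (u - v) ^+ 2 - 7^-1 * e ^+ 2.
Proof.
move=> e b err_le sub_le lam0 /andP[lb_ge lb_le].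
set r := enorm (u - v); set err := F x - F v - J *m (x - v) in err_le.
have e0 : 0 <= e by exact: enorm_ge0.
have r0 : 0 <= r by exact: enorm_ge0.
have b0 : 0 < b by rewrite -(pmulr_rgt0 _ lam0) (lt_le_trans _ lb_ge).
have FxE : F x = Omega F L1 v J delta x - (10 * b) *: (x - v) + err.
  rewrite /Omega /err /b -/e.
  have -> : 10 * (L1 / 2 * e + delta) = 10 * delta + 5 * L1 * e by field.
  by rewrite addrK addrC -[F x - F v - _]addrA -opprD subrK.
have xu_le : enorm (x - u) <= e + r.
  have -> : x - u = (x - v) + (v - u) by rewrite addrA subrK.
  by rewrite /r (enormB u v) enormD.
have prox_ge : e ^+ 2 - e * r <= dot (x - v) (x - u).
  have -> : x - u = (x - v) - (u - v) by rewrite opprB addrA subrK.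
  by rewrite dotDr dotNr -enorm_sqr lerD2l lerN2 dot_le.
have errdot_le : dot err (x - u) <= b * e * (e + r).
  apply: le_trans (dot_le _ _) _.
  by rewrite ler_pM ?enorm_ge0.
have dot_Fx : dot (F x) (x - u) <= b * (- 8 * e ^+ 2 + 11 * (e * r)).
  rewrite FxE [dot _ _]dotDl dotDl dotNl dotZl.
  have := ler_wpM2l (ltW b0) prox_ge.
  move: sub_le errdot_le; lra.
apply: le_trans (ler_wpM2l (ltW lam0) dot_Fx) _.
rewrite [leLHS]mulrA.
move: (lam * b) lb_ge lb_le => s s_ge s_le.
have sq := sqr_ge0 (r - 11 * s * e).
have se : s * (s * e ^+ 2) <= 22^-1 * (s * e ^+ 2).
  by rewrite ler_wpM2r // mulr_ge0 ?sqr_ge0 //; lra.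
have ee : 32^-1 * e ^+ 2 <= s * e ^+ 2 by rewrite ler_wpM2r ?sqr_ge0.
have ep := sqr_ge0 e.
lra.
Qed.

(** * Telescoping over a run *)

Lemma viji_sigmaE (R : realType) (d : nat) (Z : set 'cV[R]_d)
    (F : 'cV[R]_d -> 'cV[R]_d) (L1 : R) (J : nat -> 'M[R]_d) (delta : R)
    (rho : nat -> R) (tr : trajectory R d) (T k : nat) :
  viji_run Z F L1 J delta rho tr T -> (k <= T)%N ->
  tr_sigma tr k = - \sum_(j < k) tr_lam tr j *: F (tr_x tr j).
Proof.
move=> [_ sigma0 steps]; elim: k => [|k IHk] kT.
  by rewrite sigma0 big_ord0 oppr0.
have [_ [_ _ ->]] := steps k kT.
by rewrite (IHk (ltnW kT)) big_ord_recr opprD.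
Qed.

(** The left-hand side is the dual objective at [u] shifted by a quantity
    that does not depend on [u]. In the inductive step the bound is used at the
    maximizer [v_k], and the strictness of that maximum pays for the term
    [2^-1 * enorm (u - v_k) ^+ 2] of the descent estimate. *)
Lemma viji_energy (R : realType) (d : nat) (Z : set 'cV[R]_d)
    (F : 'cV[R]_d -> 'cV[R]_d) (dF : 'cV[R]_d -> 'M[R]_d) (L1 : R)
    (J : nat -> 'M[R]_d) (delta : R) (tr : trajectory R d) (T k : nat)
    (u : 'cV[R]_d) :
  compact Z -> convex_set Z ->
  (forall z, Z z -> is_jacobian_within Z F z (dF z)) ->
  lipschitz_jacobian_on Z dF L1 ->
  (forall j, Z (tr_v tr j) -> opnorm (dF (tr_v tr j) - J j) <= delta) ->
  viji_run Z F L1 J delta (fun=> delta) tr T -> (k <= T)%N -> Z u ->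
  \sum_(j < k) tr_lam tr j * dot (F (tr_x tr j)) (tr_x tr j - u)
    - 2^-1 * enorm (u - tr_z0 tr) ^+ 2
  <= - (7^-1 * \sum_(j < k) enorm (tr_x tr j - tr_v tr j) ^+ 2).
Proof.
move=> cZ cvxZ jacF lipF J_near run.
elim: k u => [|k IHk] u kT Zu.
  by rewrite !big_ord0 mulr0 sub0r oppr0 oppr_le0 mulr_ge0 ?exprn_ge0 ?enorm_ge0.
have [_ _ /(_ k kT) [[Zv vmax Zx sub_le] [lam0 lam_b _]]] := run.
pose P (y : 'cV[R]_d) := \sum_(j < k) tr_lam tr j * dot (F (tr_x tr j)) (tr_x tr j - y).
(* the sum of the first [k] terms is affine in [y] with slope [tr_sigma tr k] *)
have P_dual (y : 'cV[R]_d) : P y - 2^-1 * enorm (y - tr_z0 tr) ^+ 2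
    = P (tr_z0 tr) + dual_objective (tr_z0 tr) (tr_sigma tr k) y.
  rewrite /dual_objective (viji_sigmaE run (ltnW kT)) dotNl dot_suml addrA.
  congr (_ - _); rewrite /P -sumrB; apply: eq_bigr => j _.
  by rewrite dotZl !dotE; ring.
have := IHk _ (ltnW kT) Zv; rewrite -/(P _) P_dual.
have := dual_objective_max_gap cvxZ Zv Zu vmax.
have sub_le_u :
    dot (Omega F L1 (tr_v tr k) (J k) delta (tr_x tr k)) (tr_x tr k - u)
    <= (L1 / 2 * enorm (tr_x tr k - tr_v tr k) + delta)
       * enorm (tr_x tr k - tr_v tr k) ^+ 2.
  apply: le_trans (dot_le_sup _ cZ Zx Zu) _; apply: le_trans sub_le _.
  by rewrite le_eqVlt; apply/predU1P; left; ring.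
have := one_step_descent
  (surrogate_model_error cvxZ jacF lipF Zv Zx (J_near _ Zv)) sub_le_u lam0 lam_b.
rewrite !big_ord_recr /= -/(P u).
have := P_dual u.
lra.
Qed.

(** * Growth of the total weight *)

(** Since [lam k * (c * e k + b)] is bounded below, the weight [lam k] dominates
    a convex function of [e k]. Its tangent at the root mean square bound
    [E] of the [e k] gives a lower bound that is affine in [e k], and then
    [e k <= (e k ^+ 2 / E + E) / 2] brings in the sum of squares. *)
Lemma total_weight_ge (R : realFieldType) (T : nat) (e lam : nat -> R)
    (b c E : R) :
  0 <= b -> 0 < c -> 0 < E ->
  (forall k, (k < T)%N -> 0 <= e k) ->
  (forall k, (k < T)%N -> 0 < lam k /\ 32^-1 <= lam k * (c * e k + b)) ->
  \sum_(k < T) e k ^+ 2 <= T%:R * E ^+ 2 ->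
  T%:R <= 32 * (c * E + b) * \sum_(k < T) lam k.
Proof.
move=> b0 c0 E0 e_ge0 lamP sum_sq; set m := c * E + b.
have m0 : 0 < m by rewrite ltr_wpDr // mulr_gt0.
have lam_ge k : (k < T)%N -> 2 * m - (c * e k + b) <= 32 * m ^+ 2 * lam k.
  move=> kT; have [lam0 lamy] := lamP k kT.
  set y := c * e k + b in lamy *.
  have y0 : 0 < y.
    by rewrite -(pmulr_rgt0 _ lam0) (lt_le_trans _ lamy) // invr_gt0.
  rewrite -(ler_pM2r y0).
  have := ler_wpM2l (ltW (exprn_gt0 2 m0)) lamy.
  have := sqr_ge0 (m - y); lra.
have e_le k : (k < T)%N -> 2 * E * e k <= e k ^+ 2 + E ^+ 2.
  by move=> _; have := sqr_ge0 (e k - E); lra.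
have sum_e : 2 * E * \sum_(k < T) e k <= 2 * E * (T%:R * E).
  rewrite mulr_sumr.
  apply: (@le_trans _ _ (\sum_(k < T) (e k ^+ 2 + E ^+ 2))).
    by apply: ler_sum => k _; exact: e_le.
  by rewrite big_split /= sumr_const card_ord -[E ^+ 2 *+ T]mulr_natl; lra.
rewrite ler_pM2l ?mulr_gt0 // in sum_e.
have sum_lam : \sum_(k < T) (2 * m - (c * e k + b))
               <= 32 * m ^+ 2 * \sum_(k < T) lam k.
  by rewrite mulr_sumr; apply: ler_sum => k _; exact: lam_ge.
have m_sum : m * (32 * m * \sum_(k < T) lam k)
             = 32 * m ^+ 2 * \sum_(k < T) lam k by ring.
rewrite -(ler_pM2l m0) m_sum.
apply: le_trans sum_lam.
rewrite sumrB sumr_const card_ord big_split /= -mulr_sumr sumr_const card_ord.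
rewrite -[2 * m *+ T]mulr_natl -[b *+ T]mulr_natl.
have := ler_wpM2l (ltW c0) sum_e.
by rewrite /m; lra.
Qed.

(** * Gap of the averaged iterate *)

Lemma dot_weighted_average (R : realType) (d : nat) (tr : trajectory R d)
    (T : nat) (g z : 'cV[R]_d) :
  0 < \sum_(k < T) tr_lam tr k ->
  (\sum_(k < T) tr_lam tr k) * dot g (weighted_average tr T - z)
    = \sum_(k < T) tr_lam tr k * dot g (tr_x tr k - z).
Proof.
move=> sum_gt0; rewrite -dotZr scalerBr /weighted_average scalerA.
rewrite divff ?gt_eqF // scale1r scaler_suml -sumrB dotC dot_suml.
by apply: eq_bigr => k _; rewrite -scalerBr dotC dotZr.
Qed.

(** Convergence proofs usually bound the sum of the [e_k ^+ 2] by applying the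
    energy inequality at a solution of the variational inequality. Arguing by
    contradiction, a point [z] where the gap exceeds [eps] plays that part: the
    weighted sum is positive at [z] too. With [s = sqrt T] and [p] the cube root
    of [L1 * D ^+ 3 / eps], the resulting bound on [T] reads
    [s ^+ 3 < 16 * (p ^+ 3 + delta * D ^+ 2 / eps * s)], which contradicts
    [32 * (p ^+ 2 + delta * D ^+ 2 / eps) <= s ^+ 2] because the latter forces
    [p <= s]. *)
Lemma viji_run_gap (R : realType) (d : nat) (Z : set 'cV[R]_d)
    (F : 'cV[R]_d -> 'cV[R]_d) (dF : 'cV[R]_d -> 'M[R]_d) (L1 : R)
    (J : nat -> 'M[R]_d) (delta : R) (tr : trajectory R d) (T : nat)
    (D p eps : R) (z : 'cV[R]_d) :
  compact Z -> convex_set Z -> monotone_on Z F ->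
  (forall x, Z x -> is_jacobian_within Z F x (dF x)) ->
  0 < L1 -> lipschitz_jacobian_on Z dF L1 -> 0 <= delta ->
  (forall j, Z (tr_v tr j) -> opnorm (dF (tr_v tr j) - J j) <= delta) ->
  viji_run Z F L1 J delta (fun=> delta) tr T -> (0 < T)%N ->
  0 < D -> diameter Z <= D -> 0 < eps ->
  0 <= p -> p ^+ 3 = L1 * D ^+ 3 / eps ->
  32 * (p ^+ 2 + delta * D ^+ 2 / eps) <= T%:R ->
  Z z -> dot (F z) (weighted_average tr T - z) <= eps.
Proof.
move=> cZ cvxZ monoF jacF L1_gt0 lipF delta0 J_near run T_gt0 D0 diamD eps0.
move=> p0 p3 T_ge Zz; rewrite leNgt; apply/negP => gap_gt.
have [Zz0 _ steps] := run.
set Lam := \sum_(k < T) tr_lam tr k.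
set E2 := \sum_(k < T) enorm (tr_x tr k - tr_v tr k) ^+ 2.
have Lam0 : 0 < Lam.
  rewrite /Lam (bigD1 (Ordinal T_gt0)) //= ltr_pwDl //.
    by have [_ []] := steps 0%N T_gt0.
  by apply: sumr_ge0 => k _; have [_ [/ltW]] := steps k (ltn_ord k).
have E20 : 0 <= E2 by apply: sumr_ge0 => k _; rewrite sqr_ge0.
have energy : Lam * eps + 7^-1 * E2 < 2^-1 * D ^+ 2.
  have := viji_energy cZ cvxZ jacF lipF J_near run (leqnn T) Zz.
  rewrite -/E2.
  have : Lam * eps < Lam * dot (F z) (weighted_average tr T - z).
    by rewrite ltr_pM2l.
  rewrite (dot_weighted_average _ _ Lam0).
  have : enorm (z - tr_z0 tr) ^+ 2 <= D ^+ 2.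
    rewrite lerXn2r ?nnegrE ?enorm_ge0 ?(ltW D0) //.
    by apply: le_trans diamD; exact: enorm_le_diameter.
  have : \sum_(k < T) tr_lam tr k * dot (F z) (tr_x tr k - z)
      <= \sum_(k < T) tr_lam tr k * dot (F (tr_x tr k)) (tr_x tr k - z).
    apply: ler_sum => k _.
    have [[_ _ Zx _] [/ltW lam0 _ _]] := steps k (ltn_ord k).
    rewrite ler_wpM2l // -subr_ge0 -dotNl -dotDl.
    exact: monoF.
  lra.
have E2_le : E2 <= 4 * D ^+ 2.
  have := mulr_gt0 Lam0 eps0; have := exprn_gt0 2 D0; lra.
have Lam_lt : Lam * eps < 2^-1 * D ^+ 2 by lra.
pose s := Num.sqrt (T%:R : R).
have s2 : s ^+ 2 = T%:R by rewrite sqr_sqrtr.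
have s0 : 0 < s by rewrite sqrtr_gt0 ltr0n.
(* [E = 2 * D / s] makes [T%:R * E ^+ 2] the bound [4 * D ^+ 2] of [E2_le] *)
have T_le : T%:R <= 32 * (L1 / 2 * (2 * D / s) + delta) * Lam.
  apply: (@total_weight_ge _ _ (fun k => enorm (tr_x tr k - tr_v tr k))).
  - by [].
  - by rewrite divr_gt0.
  - by rewrite divr_gt0 // mulr_gt0.
  - by move=> k _; exact: enorm_ge0.
  - by move=> k kT; have [_ [lam0 /andP[lam_b _] _]] := steps k kT.
  - have -> : T%:R * (2 * D / s) ^+ 2 = 4 * D ^+ 2.
      by rewrite -s2; field; rewrite gt_eqF.
    exact: E2_le.
(* [T_le] multiplied by [eps * s], with [Lam * eps] bounded by [Lam_lt] *)
have cubic : eps * s ^+ 3 < 16 * (L1 * D ^+ 3 + delta * D ^+ 2 * s).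
  have m0 : 0 < 32 * (L1 * D + delta * s).
    by rewrite mulr_gt0 // ltr_wpDr ?mulr_gt0 // mulr_ge0 // ltW.
  have mE : 32 * (L1 / 2 * (2 * D / s) + delta) * s = 32 * (L1 * D + delta * s).
    by field; rewrite gt_eqF.
  have := ler_wpM2l (ltW (mulr_gt0 eps0 s0)) T_le.
  have -> : eps * s * (32 * (L1 / 2 * (2 * D / s) + delta) * Lam)
    = 32 * (L1 * D + delta * s) * (Lam * eps) by rewrite -mE; ring.
  have := Lam_lt; rewrite -(ltr_pM2l m0) -s2 => lt1 le1.
  have -> : eps * s ^+ 3 = eps * s * s ^+ 2 by ring.
  apply: le_lt_trans le1 _; apply: lt_le_trans lt1 _.
  by rewrite le_eqVlt; apply/predU1P; left; field.
have p3' : L1 * D ^+ 3 = eps * p ^+ 3 by rewrite p3; field; rewrite gt_eqF.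
set q := delta * D ^+ 2 / eps in T_ge.
have qE : delta * D ^+ 2 = eps * q by rewrite /q; field; rewrite gt_eqF.
have q0 : 0 <= q by rewrite divr_ge0 ?(ltW eps0) // mulr_ge0 ?sqr_ge0.
have : s ^+ 3 < 16 * (p ^+ 3 + q * s).
  rewrite -(ltr_pM2l eps0); apply: lt_le_trans cubic _.
  by rewrite p3' qE; lra.
have ps : p <= s.
  rewrite -(ler_pXn2r (n := 2)) ?nnegrE ?(ltW s0) // s2.
  by have := sqr_ge0 p; lra.
rewrite -s2 in T_ge.
have := ler_wpM2r (ltW s0) T_ge.
have := ler_wpM2l (sqr_ge0 p) ps.
have : 0 <= p ^+ 2 * s by rewrite mulr_ge0 ?sqr_ge0 // ltW.
have := exprn_gt0 3 s0.
lra.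
Qed.

(** A vanishing bracket forces [x_k = v_k] and [delta = 0], so that [Omega] at
    [x_k] is [F x_k] and the tolerance of the subproblem is [0]. *)
Lemma viji_stop_gap (R : realType) (d : nat) (Z : set 'cV[R]_d)
    (F : 'cV[R]_d -> 'cV[R]_d) (L1 : R) (J : nat -> 'M[R]_d) (delta : R)
    (tr : trajectory R d) (k : nat) (z : 'cV[R]_d) :
  compact Z -> monotone_on Z F -> 0 < L1 -> 0 <= delta ->
  viji_points Z F L1 J delta tr k ->
  viji_bracket L1 (fun=> delta) tr k = 0 ->
  Z z -> dot (F z) (tr_x tr k - z) <= 0.
Proof.
move=> cZ monoF L1_gt0 delta0 [_ _ Zx sub_le]; rewrite /viji_bracket => b0 Zz.
have e_ge0 := enorm_ge0 (tr_x tr k - tr_v tr k).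
have e0 : enorm (tr_x tr k - tr_v tr k) = 0.
  apply/eqP; rewrite eq_le e_ge0 andbT -(ler_pM2l (divr_gt0 L1_gt0 (ltr0n _ 2))).
  by rewrite mulr0; lra.
have xv : tr_x tr k = tr_v tr k by apply/subr0_eq/enorm_eq0.
have := dot_le_sup (Omega F L1 (tr_v tr k) (J k) delta (tr_x tr k)) cZ Zx Zz.
move=> /le_trans /(_ sub_le).
rewrite e0 !expr0n /= !mulr0 addr0 /Omega -xv subrr mulmx0 scaler0 !addr0.
apply: le_trans.
by rewrite -subr_ge0 -dotNl -dotDl; exact: monoF.
Qed.

(** * Communication counts *)

Lemma sumn_iota_const (c T : nat) : sumn [seq c | _ <- iota 0 T] = (c * T)%N.
Proof.
by rewrite -[RHS]sumn_nseq -[T in RHS](size_iota 0); elim: (iota 0 T) => //= k r ->.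
Qed.

Lemma local_jacobian_log_counts (R : realType) (d M : nat)
    (dH : 'cV[R]_d -> 'M[R]_d) (tr : trajectory R d) (T : nat) :
  let log := viji_log (local_jacobian_rule dH) tr T in
  [/\ N_sync log = (2 * T)%N, N_scal M log = (2 * M * d * T)%N,
      N_JVP log = 0%N & N_J log = 0%N].
Proof.
rewrite /N_sync /N_scal /N_JVP /N_J /viji_log map_flatten sumn_flatten.
rewrite !count_flatten -!map_comp; split=> /=.
- by rewrite -sumn_iota_const; congr sumn; exact: eq_map.
- rewrite -[RHS]sumn_iota_const; congr sumn; apply: eq_map => k /=.
  by rewrite addn0 add0n addnn -mul2n mulnA.
- by rewrite -[RHS](mul0n T) -sumn_iota_const; congr sumn; exact: eq_map.
- by rewrite -[RHS](mul0n T) -sumn_iota_const; congr sumn; exact: eq_map.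
Qed.

Theorem corollary2 (R : realType) :
  exists2 C : R, 0 < C &
  forall (d M : nat) (M_gt0 : (0 < M)%N) (Z : set 'cV[R]_d)
    (w : 'I_M -> R) (Fi : 'I_M -> 'cV[R]_d -> 'cV[R]_d)
    (dFi : 'I_M -> 'cV[R]_d -> 'M[R]_d) (L1 : R),
  let server := Ordinal M_gt0 in
  let F := fun z => \sum_(i < M) w i *: Fi i z in
  let dF := fun z => \sum_(i < M) w i *: dFi i z in
  let D := diameter Z in
  let beta := jacobian_gap Z dF (dFi server) in
  let S := local_jacobian_rule (dFi server) in
  Z !=set0 -> compact Z -> convex_set Z -> 0 < D ->
  (forall i, 0 < w i) -> \sum_(i < M) w i = 1 ->
  (forall i, C1_on Z (Fi i) (dFi i)) ->
  monotone_on Z F ->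
  0 < L1 -> lipschitz_jacobian_on Z dF L1 ->
  exists Tloc : R -> nat,
    (\forall eps \near 0^'+,
       (Tloc eps)%:R <=
         C * ((L1 * D ^+ 3 / eps) `^ (2 / 3) + beta * D ^+ 2 / eps)) /\
    forall eps : R, 0 < eps ->
    forall tr : trajectory R d,
      let J := surrogate_seq S tr in
      let rho := fun=> beta in
      (forall (T : nat) (zhat : 'cV[R]_d), (Tloc eps <= T)%N ->
         viji_output Z F L1 J beta rho tr T zhat -> gap Z F zhat <= eps) /\
      (viji_run Z F L1 J beta rho tr (Tloc eps) ->
         let log := viji_log S tr (Tloc eps) in
         [/\ N_sync log = (2 * Tloc eps)%N,
             N_scal M log = (2 * M * d * Tloc eps)%N,
             N_JVP log = 0%N &
             N_J log = 0%N]).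
Proof.
(* 32 from the iteration budget, 1 for rounding up once the bound exceeds 1 *)
exists 33 => // d M M_gt0 Z w Fi dFi L1 server F dF D beta S.
move=> [z0 Zz0] cZ cvxZ D_gt0 w_gt0 w_sum C1 monoF L1_gt0 lipF.
have jacF z : Z z -> is_jacobian_within Z F z (dF z).
  by move=> Zz; apply: jacobian_within_sum => // i; have [+ _] := C1 i; exact.
have contdF i : {within Z, continuous (dFi i)} by have [] := C1 i.
have gap_le_beta z : Z z -> opnorm (dF z - dFi server z) <= beta.
  by move=> Zz; exact: opnorm_le_jacobian_gap.
have beta_ge0 : 0 <= beta.
  by apply: le_trans (gap_le_beta _ Zz0); exact: opnorm_ge0.
pose a eps := L1 * D ^+ 3 / eps.
pose X eps := a eps `^ (2 / 3) + beta * D ^+ 2 / eps.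
have LD_gt0 : 0 < L1 * D ^+ 3 by rewrite mulr_gt0 // exprn_gt0.
have X_ge0 eps : 0 < eps -> 0 <= X eps.
  by move=> /ltW eps0; rewrite addr_ge0 ?powR_ge0 // divr_ge0 // mulr_ge0 // sqr_ge0.
exists (fun eps => (Num.truncn (32 * X eps)).+1); split.
  near=> eps.
  have eps_gt0 : 0 < eps by near: eps; exact: nbhs_right_gt.
  have X_ge1 : 1 <= X eps.
    (* small means at most [L1 * D ^+ 3] *)
    have a1 : 1 <= a eps.
      rewrite /a ler_pdivlMr // mul1r.
      by near: eps; exact: nbhs_right_le.
    rewrite /X -[leLHS]addr0 lerD //.
      apply: (@le_trans _ _ (1 `^ (2 / 3))); first by rewrite powR1.
      by rewrite ge0_ler_powR // ?nnegrE ?(le_trans ler01).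
    by rewrite divr_ge0 ?(ltW eps_gt0) // mulr_ge0 // sqr_ge0.
  have /truncn_itv/andP[trX _] : 0 <= 32 * X eps by rewrite mulr_ge0 // X_ge0.
  by rewrite -[_.+1]addn1 natrD -/(a eps) -/(X eps); lra.
move=> eps eps_gt0 tr J rho; split; last by move=> _; exact: local_jacobian_log_counts.
move=> T zhat T_ge out.
apply: gap_le => [|z Zz]; first by exists z0.
have [[run ->]|[k [_ _ pts b0 ->]]] := out; last first.
  by apply: le_trans (viji_stop_gap cZ monoF L1_gt0 beta_ge0 pts b0 Zz) (ltW _).
have a_ge0 : 0 <= a eps by rewrite divr_ge0 // ltW.
apply: (@viji_run_gap _ _ Z F dF L1 J beta tr T D (a eps `^ 3^-1) eps) => //.
- by move=> j Zv; exact: gap_le_beta.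
- exact: leq_trans T_ge.
- exact: powR_ge0.
- by rewrite -powR_mulrn ?powR_ge0 // -powRrM mulVf // powRr1.
- rewrite -powR_mulrn ?powR_ge0 // -powRrM [3^-1 * _]mulrC -/(X eps).
  apply: le_trans (ltW (truncnS_gt _)) _.
  by rewrite ler_nat.
Unshelve. all: by end_near.
Qed.
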